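(* Let $\Sigma=(A,B,C,D)$, with $A\in\mathbb{R}^{n\times n}$, $B\in\mathbb{R}^{n\times m}$, $C\in\mathbb{R}^{m\times n}$, $D\in\mathbb{R}^{m\times m}$ and $A$ Hurwitz, be a linear system $\dot x=Ax+Bu$, $y=Cx+Du$, and let $\sigma\in\mathbb{R}^{m\times m}$ be a signature matrix. For $\hat u_p\in L_2([0,\infty),\mathbb{R}^m)$ let $y_f:[0,\infty)\to\mathbb{R}^m$ be the future output of $\Sigma$ (on $[0,\infty)$) resulting from $x(-\infty)=0$ and from the input equal to $u_p(t)=\hat u_p(-t)$ for $t\in(-\infty,0]$ and to $0$ for $t\in[0,\infty)$, that is, $y_f=\mathcal{H}\hat u_p$ with $\mathcal{H}$ the Hankel operator of $\Sigma$. Then $\Sigma$ is reciprocal with respect to $\sigma$ if and only if $$\mathcal{L}:=\{(\hat u_p,\sigma y_f)\;:\;\hat u_p\in L_2([0,\infty),\mathbb{R}^m),\ y_f=\mathcal{H}\hat u_p\}$$ is a Lagrangian subspace of $L_2([0,\infty),\mathbb{R}^m)\times L_2([0,\infty),\mathbb{R}^m)$. Furthermore, the generating functional of $\mathcal{L}$ is the quadratic functional $\mathfrak{H}:L_2([0,\infty),\mathbb{R}^m)\to\mathbb{R}$ given by $\mathfrak{H}(\hat u_p)=\tfrac12\langle \hat u_p,\sigma\mathcal{H}(\hat u_p)\rangle$.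
   Context: A signature matrix is a diagonal matrix with diagonal entries $\pm1$. The system $\Sigma$ is reciprocal with respect to $\sigma$ if its transfer matrix $K(s)=C(sI-A)^{-1}B+D$ satisfies $\sigma K(s)=K^\top(s)\sigma$. The Hankel operator $\mathcal{H}:L_2([0,\infty),\mathbb{R}^m)\to L_2([0,\infty),\mathbb{R}^m)$ is $(\mathcal{H}v)(t)=\int_0^\infty Ce^{A(t+\tau)}B\,v(\tau)\,d\tau$, mapping time-reversed past inputs to future outputs. On $L_2([0,\infty),\mathbb{R}^m)\times L_2([0,\infty),\mathbb{R}^m)$, with elements $(f,e)$, consider the weak symplectic form $$\ll (f^a,e^a),(f^b,e^b)\gg:=\int_0^\infty \big(f^b(t)^\top e^a(t)-f^a(t)^\top e^b(t)\big)\,dt .$$ A subspace $\mathcal{L}$ is Lagrangian if $\mathcal{L}$ equals its orthogonal companion with respect to this form, i.e. $\mathcal{L}$ is the set of all $(f,e)$ with $\ll (f,e),(f',e')\gg=0$ for all $(f',e')\in\mathcal{L}$. A generating functional for a Lagrangian subspace $\mathcal{L}$ is a functional $\mathfrak{V}:L_2([0,\infty),\mathbb{R}^m)\to\mathbb{R}$ with $\mathcal{L}=\{(f,e): e=\frac{\delta\mathfrak{V}}{\delta f}(f)\}$, where $\frac{\delta\mathfrak{V}}{\delta f}$ is the variational derivative (the $L_2$-gradient). $\langle\cdot,\cdot\rangle$ is the $L_2$ inner product. (If $G=G^\top$ satisfies $A^\top G=GA$ and $B^\top G=\sigma C$, then $\mathfrak{H}(\hat u_p)=\tfrac12 x_0^\top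 Gx_0$ with $x_0=\int_0^\infty e^{A\tau}B\hat u_p(\tau)\,d\tau$.)
   Formalization: The direction ''L Lagrangian implies reciprocal'' is proved under the extra assumption σD = D^Tσ, which reciprocity itself forces; without it the claim fails (e.g. A = -1, B = 0, C = 0, σ = I, D not symmetric). *)

(* Defs.v *)
From HB Require Import structures.
From mathcomp Require Import all_boot all_order all_algebra.
From mathcomp Require Import all_classical all_reals all_analysis.
From mathcomp.real_closed Require Import complex.

Set Implicit Arguments.
Unset Strict Implicit.
Unset Printing Implicit Defensive.

Import Order.TTheory GRing.Theory Num.Theory.
Import numFieldNormedType.Exports.

Local Open Scope classical_set_scope.
Local Open Scope ring_scope.

Definition is_signature (R : realType) (m : nat) (sigma : 'M[R]_m) : Prop :=
  is_diag_mx sigma /\ forall i, sigma i i = 1 \/ sigma i i = -1.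

Definition complexify (R : realType) (p q : nat) (M : 'M[R]_(p, q)) :
    'M[R[i]]_(p, q) :=
  map_mx (real_complex R) M.

Definition hurwitz (R : realType) (n : nat) (A : 'M[R]_n) : Prop :=
  forall z : R[i], eigenvalue (complexify A) z -> complex.Re z < 0.

(* Only meaningful when [s] is not an eigenvalue of [A]: [invmx] is the identity
   on singular matrices. *)
Definition transfer_matrix (R : realType) (n m : nat) (A : 'M[R]_n)
    (B : 'M[R]_(n, m)) (C : 'M[R]_(m, n)) (D : 'M[R]_m) (s : R[i]) :
    'M[R[i]]_m :=
  complexify C *m invmx (s%:M - complexify A) *m complexify B + complexify D.

(* Letting s tend to infinity, the condition contains sigma D = D^T sigma, which
   the Hankel operator does not see. *)
Definition reciprocal (R : realType) (n m : nat) (A : 'M[R]_n)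
    (B : 'M[R]_(n, m)) (C : 'M[R]_(m, n)) (D sigma : 'M[R]_m) : Prop :=
  forall s : R[i], s%:M - complexify A \in unitmx ->
    complexify sigma *m transfer_matrix A B C D s =
    (transfer_matrix A B C D s)^T *m complexify sigma.

Definition expmx (R : realType) (n : nat) (M : 'M[R]_n) : 'M[R]_n :=
  lim (series (fun k : nat => (k`!%:R)^-1 *: M ^+ k) @ \oo).

(* Elements of L_2([0,oo), R^m) are represented by functions R -> R^m, of which
   only the restriction to [0,oo) matters. The predicate [L2] selects the
   representatives, [L2eq] is equality in L_2, and subsets of L_2 x L_2 are
   sets of pairs of representatives that are closed under [L2eq]. *)

Definition halfline (R : realType) : set R := `[0, +oo[%classic.

Definition L2 (R : realType) (m : nat) (f : R -> 'cV[R]_m) : Prop :=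
  forall i, (fun t => f t i 0) \_ (@halfline R)
    \in Lfun (@lebesgue_measure R) 2%:E.

Definition L2eq (R : realType) (m : nat) (f g : R -> 'cV[R]_m) : Prop :=
  f = g %[ae (@lebesgue_measure R) in @halfline R].

Definition L2inner (R : realType) (m : nat) (f g : R -> 'cV[R]_m) : R :=
  \int[@lebesgue_measure R]_(t in @halfline R) ((f t)^T *m g t) 0 0.

Definition L2pair (R : realType) (m : nat) : Type :=
  ((R -> 'cV[R]_m) * (R -> 'cV[R]_m))%type.

Definition symplectic_form (R : realType) (m : nat) (a b : L2pair R m) : R :=
  \int[@lebesgue_measure R]_(t in @halfline R)
    (((b.1 t)^T *m a.2 t) 0 0 - ((a.1 t)^T *m b.2 t) 0 0).

Definition orthogonal_companion (R : realType) (m : nat)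
    (S : set (L2pair R m)) : set (L2pair R m) :=
  [set a | [/\ L2 a.1, L2 a.2 & forall b, S b -> symplectic_form a b = 0]].

Definition linear_subspace (R : realType) (m : nat)
    (S : set (L2pair R m)) : Prop :=
  [/\ (forall a, S a -> L2 a.1 /\ L2 a.2),
      (forall a b, S a -> L2 b.1 -> L2 b.2 ->
         L2eq a.1 b.1 -> L2eq a.2 b.2 -> S b),
      S (fun=> 0, fun=> 0) &
      (forall (c : R) a b, S a -> S b ->
         S (fun t => c *: a.1 t + b.1 t, fun t => c *: a.2 t + b.2 t))].

Definition lagrangian (R : realType) (m : nat) (S : set (L2pair R m)) : Prop :=
  linear_subspace S /\ S = orthogonal_companion S.

(* The L_2-gradient, in the sense of directional derivatives. *)
Definition is_variational_derivative (R : realType) (m : nat)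
    (V : (R -> 'cV[R]_m) -> R) (f g : R -> 'cV[R]_m) : Prop :=
  L2 g /\
  forall h, L2 h ->
    is_derive (0 : R) (1 : R) (fun eps : R => V (fun t => f t + eps *: h t))
      (L2inner g h).

(* The first clause makes [V] a functional on L_2, i.e., on classes. *)
Definition is_generating_functional (R : realType) (m : nat)
    (S : set (L2pair R m)) (V : (R -> 'cV[R]_m) -> R) : Prop :=
  (forall f g, L2 f -> L2 g -> L2eq f g -> V f = V g) /\
  S = [set a | L2 a.1 /\ is_variational_derivative V a.1 a.2].

Definition hankel (R : realType) (n m : nat) (A : 'M[R]_n)
    (B : 'M[R]_(n, m)) (C : 'M[R]_(m, n)) (v : R -> 'cV[R]_m) (t : R) :
    'cV[R]_m :=
  \col_i \int[@lebesgue_measure R]_(tau in @halfline R)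
    (C *m expmx ((t + tau) *: A) *m B *m v tau) i 0.

(* The set of all (u, sigma y) with u in L_2 and y = H u: membership of the
   second component in L_2 is automatic when A is Hurwitz. *)
Definition hankel_graph (R : realType) (n m : nat) (A : 'M[R]_n)
    (B : 'M[R]_(n, m)) (C : 'M[R]_(m, n)) (sigma : 'M[R]_m) :
    set (L2pair R m) :=
  [set a | [/\ L2 a.1, L2 a.2 &
     L2eq a.2 (fun t => sigma *m hankel A B C a.1 t)]].

Definition hankel_functional (R : realType) (n m : nat) (A : 'M[R]_n)
    (B : 'M[R]_(n, m)) (C : 'M[R]_(m, n)) (sigma : 'M[R]_m)
    (u : R -> 'cV[R]_m) : R :=
  2^-1 * L2inner u (fun t => sigma *m hankel A B C u t).

(* Main.v *)
Require Import Defs.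
From HB Require Import structures.
From mathcomp Require Import all_boot all_order all_algebra.
From mathcomp Require Import all_classical all_reals all_analysis.
From mathcomp.real_closed Require Import complex.
From mathcomp Require Import measurable_realfun ring lra.

Set Implicit Arguments.
Unset Strict Implicit.
Unset Printing Implicit Defensive.

Import Order.TTheory GRing.Theory Num.Theory.
Import numFieldNormedType.Exports.

Local Open Scope classical_set_scope.
Local Open Scope ring_scope.

(* The kernel of the Hankel operator factors, C e^((t+tau)A) B =
   (C e^(tA)) (e^(tau A) B), so <v, sigma H u> is the product of a row vector
   depending on v and the state reached from u. The graph of sigma H is Lagrangian
   iff this bilinear form is symmetric, since the inner product of L_2 is
   nondegenerate, and a symmetric form is the derivative of half its quadratic
   form. Symmetry of the form is equivalent to symmetry of all the
   sigma C A^k B: one way by expanding the exponential, the other way by inserting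
   exponential inputs, which turns the form into resolvents of A. Cayley-Hamilton
   relates the sigma C A^k B to the transfer matrix. That e^(tA) has entries in L_2
   comes from d/dt (P e^(tA)) = P A e^(tA): the eigenvalues of A are split off one by
   one by an energy estimate. *)

(** * Resolvents and the characteristic polynomial *)

(* (chi(s) - chi(A)) / (s - A), expanded in powers of A; chi(A) = 0. *)
Definition resolvent_poly (F : fieldType) (n : nat) (A : 'M[F]_n) (s : F) :
    'M[F]_n :=
  \sum_(k < (size (char_poly A)))
    (char_poly A)`_k *: \sum_(i < k) s ^+ (k.-1 - i) *: A ^+ i.

(** Each power telescopes, s^k - A^k = (s - A) * sum of s^(k-1-i) A^i; summing against the
    coefficients of chi leaves chi(s) - chi(A), and chi(A) = 0 by Cayley-Hamilton. *)
Lemma mul_resolvent_poly (F : fieldType) (n : nat) (A : 'M[F]_n) (s : F) :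
  (s%:M - A) *m resolvent_poly A s = (char_poly A).[s]%:M.
Proof.
case: n A => [|n] A; first by apply/matrixP => -[].
have comms : GRing.comm s%:M A by rewrite /GRing.comm -!mulmxE scalar_mxC.
rewrite /resolvent_poly mulmx_sumr horner_coef raddf_sum /=.
have := Cayley_Hamilton A; rewrite /horner_mx /horner_morph.
rewrite horner_coef size_map_poly => CH.
rewrite -[RHS]subr0 -[X in _ = _ - X]CH -sumrB; apply: eq_bigr => k _.
rewrite coef_map /= -scalemxAr mulmxE.
have -> : (\sum_(i < k) s ^+ (k.-1 - i) *: A ^+ i) =
    \sum_(i < k) (s%:M : 'M[F]_n.+1) ^+ (k.-1 - i) * A ^+ i.
  by apply: eq_bigr => i _; rewrite -rmorphXn /= -mulmxE mul_scalar_mx.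
rewrite -subrXX_comm// -rmorphXn /= scalerBr -!mul_scalar_mx -scalar_mxM.
by rewrite mulmxE.
Qed.

Lemma horner_char_poly_neq0 (F : fieldType) (n : nat) (A : 'M[F]_n) (s : F) :
  s%:M - A \in unitmx -> (char_poly A).[s] != 0.
Proof.
move=> u; apply/negP => ev; have : eigenvalue A s.
  by rewrite eigenvalue_root_char rootE.
move=> /eigenvalueP[v /eqP]; rewrite -mul_mx_scalar -subr_eq0 -mulmxBr => + /negP.
rewrite -opprB mulmxN oppr_eq0 => /eqP /(congr1 (mulmx^~ (invmx (s%:M - A)))).
by rewrite mulmxK// mul0mx => -> [].
Qed.

Lemma invmx_resolvent (F : fieldType) (n : nat) (A : 'M[F]_n) (s : F) :
  s%:M - A \in unitmx ->
  invmx (s%:M - A) = (char_poly A).[s]^-1 *: resolvent_poly A s.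
Proof.
move=> u; have c0 := horner_char_poly_neq0 u.
have := congr1 (mulmx (invmx (s%:M - A))) (mul_resolvent_poly A s).
rewrite mulKmx// mul_mx_scalar => ->.
by rewrite scalerA mulVf// scale1r.
Qed.

Lemma resolvent_identity (F : fieldType) (n : nat) (A : 'M[F]_n) (s t : F) :
  s%:M - A \in unitmx -> t%:M - A \in unitmx ->
  invmx (s%:M - A) - invmx (t%:M - A) =
  (t - s) *: (invmx (t%:M - A) *m invmx (s%:M - A)).
Proof.
move=> us ut.
transitivity (invmx (t%:M - A) *m ((t%:M - A) - (s%:M - A)) *m invmx (s%:M - A)).
  by rewrite mulmxBr mulmxBl mulVmx// mul1mx -mulmxA mulmxV// mulmx1.
by rewrite opprB addrA subrK -raddfB mul_mx_scalar -scalemxAl.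
Qed.

(** Swapping s and t in the resolvent identity only changes the sign of the left side, so the two
    products agree once the nonzero factor s - t is cancelled. *)
Lemma resolvent_comm (F : fieldType) (n : nat) (A : 'M[F]_n) (s t : F) :
  s%:M - A \in unitmx -> t%:M - A \in unitmx ->
  comm_mx (invmx (s%:M - A)) (invmx (t%:M - A)).
Proof.
move=> us ut; have [->//|st] := eqVneq s t.
have := congr1 -%R (resolvent_identity us ut).
rewrite opprB (resolvent_identity ut us) -scaleNr opprB => /scalerI; apply.
by rewrite subr_eq0.
Qed.

(** * Linear functionals evaluated on resolvents *)

Section LinearFunctional.
Variables (F : fieldType) (n : nat) (A : 'M[F]_n).
Variable phi : {linear 'M[F]_n -> F^o}.

Lemma resolvent_eq0 (s : F) : (forall k, phi (A ^+ k) = 0) ->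
  s%:M - A \in unitmx -> phi (invmx (s%:M - A)) = 0.
Proof.
move=> phi0 u; rewrite invmx_resolvent// linearZ /=.
rewrite /resolvent_poly linear_sum big1 => [|k _]; first exact: scaler0.
rewrite linearZ linear_sum big1 => [|i _]; first exact: scaler0.
by rewrite linearZ /= phi0 scaler0.
Qed.

(** Multiplied by chi(s), the value of phi on the resolvent is a polynomial [q] of degree below n.
    If it agrees with c * chi(s) at n+1 points, the two polynomials coincide, and degree n on the
    right forces c = 0. *)
Lemma resolvent_const_eq0 (rs : nat -> F) (c : F) : injective rs ->
  (forall N, (rs N)%:M - A \in unitmx) ->
  (forall N, phi (invmx ((rs N)%:M - A)) = c) -> c = 0.
Proof.
move=> injg ug phic; apply/eqP/negPn/negP => c0.
pose q : {poly F} := \sum_(k < size (char_poly A))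
    (char_poly A)`_k *: \sum_(i < k) phi (A ^+ i) *: 'X^(k.-1 - i).
have qE s : q.[s] = phi (resolvent_poly A s).
  rewrite /q /resolvent_poly linear_sum horner_sum; apply: eq_bigr => k _.
  rewrite hornerZ linearZ; congr (_ * _); rewrite linear_sum horner_sum.
  by apply: eq_bigr => i _; rewrite hornerZ linearZ hornerXn mulrC.
have sq : (size q <= n)%N.
  apply: leq_trans (size_sum _ _ _) _; apply/bigmax_leqP => k _.
  apply: leq_trans (size_scale_leq _ _) _.
  apply: leq_trans (size_sum _ _ _) _; apply/bigmax_leqP => i _.
  apply: leq_trans (size_scale_leq _ _) _; rewrite size_polyXn.
  have := leq_trans (ltn_ord k) (eq_leq (size_char_poly A)); rewrite ltnS => kn.
  (* The exponent k-1-i is at most k-1, and k is positive because it exceeds the index i; hence the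
     exponent is below k, which is at most n. *)
  rewrite (leq_ltn_trans (leq_subr _ _))// (leq_trans _ kn)// prednK//.
  exact: leq_ltn_trans (leq0n i) (ltn_ord i).
have pE : q = c *: char_poly A.
  apply/eqP; rewrite -subr_eq0; apply/eqP.
  apply: (@roots_geq_poly_eq0 _ _ [seq rs i | i <- iota 0 n.+1]).
  - apply/allP => _ /mapP[i _ ->]; rewrite rootE hornerD hornerN hornerZ qE.
    have := invmx_resolvent (ug i) => /(congr1 phi); rewrite phic linearZ => ->.
    by rewrite /= mulrC mulVKf ?subrr// horner_char_poly_neq0.
  - by rewrite map_inj_uniq// iota_uniq.
  - rewrite size_map size_iota (leq_trans (size_polyD _ _))// geq_max.
    by rewrite leqW//= size_polyN (leq_trans (size_scale_leq _ _))// size_char_poly.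
move: sq; rewrite pE size_scale// size_char_poly.
by rewrite ltnn.
Qed.

End LinearFunctional.

(** An algebraic substitute for the expansion of the resolvent at infinity. From A (s - A)^-1 = s (s
    - A)^-1 - 1 and the vanishing of phi on the resolvents, the functional phi(A -) is again
    constant on them, equal to - phi(1). So phi(1) = 0, and induction applied to phi(A -) reaches
    the higher powers. *)
Lemma resolvent_const_expr_eq0 (F : fieldType) (n : nat) (A : 'M[F]_n)
    (rs : nat -> F) (k : nat) (phi : {linear 'M[F]_n -> F^o}) (c : F) :
  injective rs -> (forall N, (rs N)%:M - A \in unitmx) ->
  (forall N, phi (invmx ((rs N)%:M - A)) = c) -> phi (A ^+ k) = 0.
Proof.
move=> injg ug; elim: k phi c => [|k IH] phi c phic.
all: have c0 := resolvent_const_eq0 injg ug phic; subst c.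
all: have phiA N : (phi \o mulmx A) (invmx ((rs N)%:M - A)) = - phi 1.
1,3: have /(congr1 phi) : A *m invmx ((rs N)%:M - A) =
      rs N *: invmx ((rs N)%:M - A) - 1%:M.
1,3: by rewrite -[in RHS](mulmxV (ug N)) mulmxBl mul_scalar_mx opprB addrCA subrr addr0.
1,2: by rewrite /= linearB linearZ /= phic scaler0 sub0r.
- by apply/eqP; rewrite -oppr_eq0; apply/eqP/(resolvent_const_eq0 injg ug phiA).
- by have := IH _ _ phiA; rewrite exprS.
Qed.

(** * Antisymmetric parts, Markov parameters and reciprocity *)

Section AntisymmetricPart.
Variables (F : fieldType) (n m : nat) (P : 'M[F]_(m, n)) (B : 'M[F]_(n, m)).
Variables (i j : 'I_m).

(** Made a linear functional of the middle factor [M], so that symmetry questions reduce, entry by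
    entry, to functionals on resolvents and powers of A. *)
Definition antisym_entry (M : 'M[F]_n) : F^o :=
  (P *m M *m B) i j - (P *m M *m B) j i.

Let antisym_entry_linear : linear antisym_entry.
Proof.
move=> c M N; rewrite /antisym_entry mulmxDr mulmxDl -scalemxAr -scalemxAl !mxE.
by rewrite scalerBr opprD addrACA.
Qed.

HB.instance Definition _ :=
  GRing.isLinear.Build F 'M[F]_n F^o *:%R antisym_entry antisym_entry_linear.

Lemma antisym_entry0 (M : 'M[F]_n) :
  (P *m M *m B)^T = P *m M *m B -> antisym_entry M = 0.
Proof. by rewrite /antisym_entry => {1}<-; rewrite mxE subrr. Qed.

End AntisymmetricPart.

Lemma trmx_signature (R : realType) (m : nat) (sigma : 'M[R]_m) :
  is_signature sigma -> sigma^T = sigma.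
Proof.
move=> [/is_diag_mxP diag _]; apply/matrixP => i j; rewrite mxE.
by have [->//|ij] := eqVneq i j; rewrite !diag// eq_sym.
Qed.

Lemma unitmx_eigenvalue (F : fieldType) (n : nat) (A : 'M[F]_n) (s : F) :
  (s%:M - A \in unitmx) = ~~ eigenvalue A s.
Proof.
rewrite /eigenvalue /eigenspace negbK kermx_eq0 row_free_unit.
by rewrite -opprB -scaleN1r unitmxZ// unitrN1.
Qed.

Lemma complexify_scalar_sub (R : realType) (n : nat) (A : 'M[R]_n) (r : R) :
  (r%:C)%C%:M - complexify A = complexify (r%:M - A).
Proof. by rewrite /complexify map_mxB map_scalar_mx. Qed.

Lemma hurwitz_unitmx (R : realType) (n : nat) (A : 'M[R]_n) (r : R) :
  hurwitz A -> 0 <= r -> r%:M - A \in unitmx.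
Proof.
move=> hA r0; rewrite -(map_unitmx (real_complex R)).
rewrite -[map_mx _ _]complexify_scalar_sub unitmx_eigenvalue.
by apply/negP => /hA /=; rewrite ltNge r0.
Qed.

Section Markov.
Variables (R : realType) (n m : nat) (A : 'M[R]_n) (B : 'M[R]_(n, m)).
Variables (C : 'M[R]_(m, n)) (D sigma : 'M[R]_m).
Hypothesis hsigma : is_signature sigma.

(** The matrices C A^k B are the Markov parameters of the system. *)
Definition markov_symmetric : Prop := forall k,
  (sigma *m C *m A ^+ k *m B)^T = sigma *m C *m A ^+ k *m B.

(** The points 0, 1, 2, ... are not eigenvalues of a Hurwitz matrix. Reciprocity there is a real
    identity, saying that the antisymmetric part of sigma C (N - A)^-1 B is a constant determined by
    D, independent of N. *)
Lemma reciprocal_markov : hurwitz A ->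
  reciprocal A B C D sigma -> markov_symmetric.
Proof.
move=> hA rec k; apply/matrixP => i j; rewrite mxE; apply/esym/eqP.
rewrite -subr_eq0; apply/eqP.
have inj : injective (fun N : nat => N%:R : R) by move=> a b /eqP; rewrite eqr_nat => /eqP.
have ug N : (N%:R)%:M - A \in unitmx by exact: hurwitz_unitmx.
apply: (@resolvent_const_expr_eq0 _ _ _ _ k (antisym_entry (sigma *m C) B i j)
  (- (sigma *m D - D^T *m sigma) i j) inj ug) => N.
have := rec ((N%:R)%:C)%C; rewrite complexify_scalar_sub map_unitmx ug => /(_ isT).
rewrite /transfer_matrix complexify_scalar_sub /complexify -map_invmx.
rewrite -!map_mxM -map_mxD map_trmx -!map_mxM => /map_mx_inj.
move=> /matrixP/(_ i j).
rewrite mulmxDr linearD /= mulmxDl -{3}(trmx_signature hsigma) -trmx_mul.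
rewrite !mulmxA /antisym_entry !mxE => /eqP; rewrite -subr_eq0 opprD addrACA.
by rewrite addr_eq0 => /eqP ->.
Qed.

(** The resolvent is a polynomial in A, so symmetry for all powers of A passes to sigma C (s - A)^-1
    B; the feedthrough term is symmetric by assumption. *)
Lemma markov_reciprocal : sigma *m D = D^T *m sigma ->
  markov_symmetric -> reciprocal A B C D sigma.
Proof.
move=> hD hM s us; rewrite /transfer_matrix.
rewrite mulmxDr linearD /= mulmxDl; congr (_ + _); last first.
  by rewrite /complexify map_trmx -!map_mxM hD.
set X := invmx _.
have -> : complexify sigma = (complexify sigma)^T.
  by rewrite /complexify map_trmx trmx_signature.
rewrite -trmx_mul !mulmxA; apply/matrixP => i j; rewrite [RHS]mxE; apply/eqP.
rewrite -subr_eq0 {1 2}/complexify map_trmx trmx_signature// -map_mxM.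
apply/eqP/(@resolvent_eq0 _ _ _ (antisym_entry _ _ _ _)) => // k.
apply: antisym_entry0.
have -> : (complexify A) ^+ k = complexify (A ^+ k).
  elim: k => [|k IH]; first by rewrite !expr0 /complexify map_mx1.
  by rewrite !exprS /complexify -mulmxE map_mxM; congr (_ *m _).
by rewrite /complexify -!map_mxM map_trmx hM.
Qed.

End Markov.

(** * The matrix exponential: convergence, derivative, semigroup law *)

Lemma cvg_mxP (R : realType) (p q : nat) (T : Type) (G : set_system T)
    (FG : Filter G) (f : T -> 'M[R]_(p, q)) (l : 'M[R]_(p, q)) :
  (forall i j, f x i j @[x --> G] --> l i j) -> f x @[x --> G] --> l.
Proof.
(* A neighbourhood of a matrix contains a box of neighbourhoods of its finitely many entries. *)
move=> fl U [P nP PU]; rewrite /nbhs /=.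
have : \forall x \near G, forall ij : 'I_p * 'I_q, P ij.1 ij.2 (f x ij.1 ij.2).
  by apply: filter_forall => -[i j] /=; apply: fl; exact: nP.
by apply: filterS => x Px; apply: PU => i j; exact: (Px (i, j)).
Qed.

Lemma cvg_mulmx_entry (R : realType) (a p q b : nat) (T : Type)
    (G : set_system T) (FG : Filter G) (f : T -> 'M[R]_(p, q))
    (l : 'M[R]_(p, q)) (P : 'M[R]_(a, p)) (Q : 'M[R]_(q, b)) i j :
  (forall i j, f x i j @[x --> G] --> l i j) ->
  (P *m f x *m Q) i j @[x --> G] --> (P *m l *m Q) i j.
Proof.
move=> fl; rewrite mxE.
have -> : (fun x => (P *m f x *m Q) i j) =
    (fun x => \sum_k (\sum_h P i h * f x h k) * Q k j).
  by apply/funext => x; rewrite mxE; apply: eq_bigr => k _; rewrite mxE.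
apply: cvg_big => [|k _]; first exact: add_continuous.
apply: cvgMr_tmp; rewrite mxE.
by apply: cvg_big => [|h _]; [exact: add_continuous|exact: cvgMl_tmp].
Qed.

Section MatrixExponential.
Variables (R : realType) (n : nat) (A : 'M[R]_n).

Lemma expr_entry_bound i j k :
  `|(A ^+ k) i j| <= (\sum_i \sum_j `|A i j|) ^+ k.
Proof.
elim: k i j => [|k IH] i j.
  rewrite !expr0 mxE; case: (i == j); by rewrite ?normr1 ?normr0.
rewrite !exprS mxE (le_trans (ler_norm_sum _ _ _))//.
apply: (@le_trans _ _ (\sum_h `|A i h| * (\sum_i \sum_j `|A i j|) ^+ k)).
  by apply: ler_sum => h _; rewrite normrM ler_wpM2l.
rewrite -mulr_suml ler_wpM2r ?exprn_ge0 ?sumr_ge0//.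
  by move=> h _; exact: sumr_ge0.
by rewrite [leRHS](bigD1 i)//= lerDl sumr_ge0// => h _; exact: sumr_ge0.
Qed.

(** Coefficients in t of the scalar power series of an entry of P e^(tA) Q. The outer factors make
    the family stable under differentiation, which replaces P by P A. *)
Definition expmx_coef (p q : nat) (P : 'M[R]_(p, n)) (Q : 'M[R]_(n, q)) i j
    (k : nat) : R :=
  (k`!%:R)^-1 * (P *m A ^+ k *m Q) i j.

Let partial_sum (t : R) := series (fun k => (k`!%:R)^-1 *: (t *: A) ^+ k).

Let exprZmx (t : R) k : (t *: A) ^+ k = t ^+ k *: A ^+ k.
Proof.
elim: k => [|k IH]; first by rewrite !expr0 scale1r.
by rewrite !exprS IH -!mulmxE -scalemxAl -scalemxAr scalerA.
Qed.

Let mul_partial_sum (p q : nat) (P : 'M[R]_(p, n)) (Q : 'M[R]_(n, q)) t i j :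
  (fun N => (P *m partial_sum t N *m Q) i j) =
  pseries (expmx_coef P Q i j) t.
Proof.
apply/funext => N; rewrite /partial_sum /pseries /series /=.
rewrite mulmx_sumr mulmx_suml summxE; apply: eq_bigr => k _.
rewrite exprZmx scalerA -scalemxAr -scalemxAl mxE /expmx_coef.
by rewrite mulrAC.
Qed.

Let cvg_partial_sum (t : R) :
  exists l : 'M[R]_n, forall i j, partial_sum t N i j @[N --> \oo] --> l i j.
Proof.
exists (\matrix_(i, j) limn (fun N => partial_sum t N i j)) => i j.
rewrite mxE.
have -> : (fun N => partial_sum t N i j) = pseries (expmx_coef 1%:M 1%:M i j) t.
  by rewrite -mul_partial_sum; apply/funext => N; rewrite mul1mx mulmx1.
apply: normed_cvg.
pose a := \sum_i \sum_j `|A i j|.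
have a0 : 0 <= a by apply: sumr_ge0 => h _; exact: sumr_ge0.
(* Absolute convergence by comparison with the scalar exponential series at a|t|, where a is the sum
   of all absolute entries of A. *)
apply: (@series_le_cvg _ _ (exp_coeff (a * `|t|))) => //.
- by move=> k /=; exact: normr_ge0.
- by move=> k; rewrite /exp_coeff /= divr_ge0// exprn_ge0// mulr_ge0.
- move=> k; rewrite /exp_coeff /expmx_coef /= mul1mx mulmx1 !normrM normrX.
  rewrite normfV [X in X^-1]ger0_norm// exprMn mulrC [leLHS]mulrA mulrAC.
  rewrite ler_wpM2r ?invr_ge0// [leLHS]mulrC ler_wpM2r ?exprn_ge0//.
  exact: expr_entry_bound.
- exact: is_cvg_series_exp_coeff.
Qed.

Lemma expmx_pseries (p q : nat) (P : 'M[R]_(p, n)) (Q : 'M[R]_(n, q)) t i j :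
  pseries (expmx_coef P Q i j) t @ \oo --> (P *m expmx (t *: A) *m Q) i j.
Proof.
have [l ll] := cvg_partial_sum t; rewrite -mul_partial_sum.
suff -> : expmx (t *: A) = l by exact: cvg_mulmx_entry.
by apply: cvg_lim => //; exact: cvg_mxP.
Qed.

Lemma expmx0 : expmx (0 *: A) = 1%:M.
Proof.
apply/matrixP => i j; have := @expmx_pseries _ _ 1%:M 1%:M 0 i j.
rewrite mul1mx mulmx1 => /cvg_lim <- //; apply: cvg_lim => //.
(* The partial sum of index 0 is empty; from index 1 on the partial sums at t = 0 are constant,
   hence the shift. *)
rewrite -(cvg_shiftS (pseries _ _)) /=.
rewrite (_ : (fun N => _) = cst (1%:M i j)); first exact: cvg_cst.
apply/funext => N /=; rewrite /pseries /series /= big_nat_recl// big1_seq.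
  by rewrite /expmx_coef expr0 mulmx1 fact0 invr1 mul1r mulmx1 expr0 mulr1 addr0.
by move=> k _; rewrite expr0n mulr0.
Qed.

Lemma expmx_comm t : expmx (t *: A) *m A = A *m expmx (t *: A).
Proof.
apply/matrixP => i j.
have := @expmx_pseries _ _ 1%:M A t i j; rewrite mul1mx => /cvg_lim <- //.
have := @expmx_pseries _ _ A 1%:M t i j; rewrite mulmx1 => /cvg_lim <- //.
congr (limn (pseries _ _)); apply/funext => k; rewrite /expmx_coef.
by rewrite mul1mx mulmx1 mulmxE -exprS -exprSr.
Qed.

End MatrixExponential.

Lemma is_derive_mulmx (R : realType) (p q r : nat) (F : R -> 'M[R]_(p, q))
    (G : R -> 'M[R]_(q, r)) (dF : 'M[R]_(p, q)) (dG : 'M[R]_(q, r)) (t : R) :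
  (forall i j, is_derive t (1 : R) (fun s => F s i j) (dF i j)) ->
  (forall i j, is_derive t (1 : R) (fun s => G s i j) (dG i j)) ->
  forall i j, is_derive t (1 : R) (fun s => (F s *m G s) i j)
    ((dF *m G t + F t *m dG) i j).
Proof.
move=> hF hG i j.
have -> : (fun s => (F s *m G s) i j) =
    \sum_(k < q) ((fun s => F s i k) * (fun s => G s k j)).
  by apply/funext => s; rewrite mxE fct_sumE.
rewrite !mxE -big_split /=; apply: is_derive_sum => k.
apply: (@is_derive_eq _ _ _ _ _ _ _ _ (is_deriveM (hF i k) (hG k j))).
by rewrite addrC; congr (_ + _); rewrite /GRing.scale /= mulrC.
Qed.

Section MatrixExponentialDerivative.
Variables (R : realType) (n : nat) (A : 'M[R]_n).

Local Notation E t := (expmx (t *: A)).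

Lemma is_derive_mul_expmx (p q : nat) (P : 'M[R]_(p, n)) (Q : 'M[R]_(n, q))
    t i j :
  is_derive t (1 : R) (fun s => (P *m E s *m Q) i j) ((P *m A *m E t *m Q) i j).
Proof.
have coefD P' : pseries_diffs (expmx_coef A P' Q i j) = expmx_coef A (P' *m A) Q i j.
  apply/funext => k; rewrite /pseries_diffs /expmx_coef factS natrM invfM.
  rewrite mulrA mulVKf ?pnatr_eq0// exprS -mulmxE mulmxA.
  by [].
have cvgc P' x : cvgn (pseries (expmx_coef A P' Q i j) x).
  by apply/cvg_ex; eexists; exact: expmx_pseries.
have -> : (fun s => (P *m E s *m Q) i j) =
    (fun s => limn (pseries (expmx_coef A P Q i j) s)).
  by apply/funext => s; apply/esym/cvg_lim => //; exact: expmx_pseries.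
have -> : (P *m A *m E t *m Q) i j = limn (pseries (expmx_coef A (P *m A) Q i j) t).
  by apply/esym/cvg_lim => //; exact: expmx_pseries.
(* Termwise differentiation needs convergence at some point of modulus larger than |t|; |t| + 1 will
   do. *)
rewrite -coefD; apply: (@pseries_snd_diffs _ _ (`|t| + 1)); rewrite ?coefD//.
by rewrite [ltRHS]ger0_norm ?ltrDl// addr_ge0.
Qed.

Lemma is_derive_expmx t i j :
  is_derive t (1 : R) (fun s => E s i j) ((A *m E t) i j).
Proof.
have := @is_derive_mul_expmx _ _ 1%:M 1%:M t i j.
rewrite mul1mx mulmx1; congr (is_derive _ _ _ _).
by apply/funext => s; rewrite mul1mx mulmx1.
Qed.

(** E(s + t - x) E(x) has zero derivative in x because A commutes with its exponential; its values
    at x = 0 and x = t are the two sides. *)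
Lemma expmxD s t : E (s + t) = E s *m E t.
Proof.
apply/matrixP => i j.
pose f x := (E (s + t - x) *m E x) i j.
have df x : is_derive x (1 : R) f 0.
  have d1 i' k : is_derive x (1 : R) (fun y => E (s + t - y) i' k)
      ((- (A *m E (s + t - x))) i' k).
    have dg : is_derive x (1 : R) (fun y : R => s + t - y) (- 1).
      by apply: is_derive_eq; rewrite add0r mul1r.
    have := @is_derive1_comp R (fun y : R => E y i' k) (fun y : R => s + t - y) x _ _
      (is_derive_expmx _ _ _) dg.
    by rewrite mulrN1 [X in _ -> is_derive _ _ _ X]mxE.
  have := is_derive_mulmx d1 (is_derive_expmx x) i j.
  rewrite mulmxA -[A *m _]expmx_comm mulNmx addNr mxE.
  by [].
have := is_derive_0_is_cst 0 t df.
rewrite /f subr0 addrK => <-.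
by rewrite expmx0 mulmx1.
Qed.

End MatrixExponentialDerivative.

(** * Exponential decay of the exponential of a Hurwitz matrix *)

Definition exp_decay (R : realType) (f : R -> R) : Prop :=
  exists K w : R, 0 < w /\ forall t, 0 <= t -> `|f t| <= K * expR (- (w * t)).

(** Squaring doubles the rate w; the bound is relaxed to any rate up to w so that several functions
    can share one rate. *)
Lemma exp_decay_sqr (R : realType) (f : R -> R) :
  exp_decay f -> exists L w : R,
    [/\ 0 <= L, 0 < w & forall v t, v <= w -> 0 <= t ->
      f t ^+ 2 <= L * expR (- (v * t))].
Proof.
move=> [K [w [w0 fK]]]; exists (K ^+ 2), w; split => //; first exact: sqr_ge0.
move=> v t vw t0; rewrite -real_normK ?num_real//.
apply: (@le_trans _ _ ((K * expR (- (w * t))) ^+ 2)).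
  by rewrite ler_sqr ?nnegrE// ?fK// (le_trans _ (fK _ t0)).
rewrite exprMn ler_wpM2l ?sqr_ge0// -expRM_natl ler_expR mulrN lerN2.
by rewrite mulr_natl mulr2n (le_trans (ler_wpM2r t0 vw))// lerDl mulr_ge0// ltW.
Qed.

Section DecayStep.
Variables (R : realType) (a b g h : R -> R) (al be : R).
Hypothesis al0 : al < 0.
Hypothesis da : forall t, is_derive t (1 : R) a (al * a t - be * b t + g t).
Hypothesis db : forall t, is_derive t (1 : R) b (be * a t + al * b t + h t).

(* With N = a^2 + b^2, AM-GM gives N' <= al N + (g^2 + h^2) / (- al), so that
   exp(- al t) N - M exp((- al - d) t) is nonincreasing for suitable d and M. *)
Lemma exp_decay_step : exp_decay g -> exp_decay h -> exp_decay a /\ exp_decay b.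
Proof.
move=> /exp_decay_sqr[K1 [w1 [K10 w10 gK]]] /exp_decay_sqr[K2 [w2 [K20 w20 hK]]].
pose c := - al; have c0 : 0 < c by rewrite oppr_gt0.
(* A common rate for g and h, kept strictly below c so that c - d is positive. *)
pose d := Num.min (Num.min w1 w2) (c / 2).
have d0 : 0 < d by rewrite !lt_min w10 w20 divr_gt0.
have dw1 : d <= w1 by rewrite !ge_min lexx.
have dw2 : d <= w2 by rewrite !ge_min lexx orbT.
have dc : d < c.
  by rewrite (@le_lt_trans _ _ (c / 2))// ?ge_min ?lexx ?orbT// gtr_pMr// invf_lt1// ltr1n.
(* Chosen so that M (c - d) = (K1 + K2) / c, which cancels the forcing term in the derivative of
   [Phi]. *)
pose M := (K1 + K2) / c / (c - d).
have cd0 : 0 < c - d by rewrite subr_gt0.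
have M0 : 0 <= M by rewrite !divr_ge0 ?(ltW c0) ?(ltW cd0) ?addr_ge0.
pose N t := a t ^+ 2 + b t ^+ 2.
pose dN t := 2 * (a t * (al * a t - be * b t + g t) +
                  b t * (be * a t + al * b t + h t)).
have isdN t : is_derive t (1 : R) N (dN t).
  rewrite /N; apply: is_derive_eq.
  by rewrite /dN /GRing.scale /=; ring.
have dNle t : 0 <= t -> dN t <= - c * N t + (K1 + K2) / c * expR (- (d * t)).
  move=> t0; have := gK d t dw1 t0; have := hK d t dw2 t0 => hb gb.
  apply: (@le_trans _ _ (- c * N t + (g t ^+ 2 + h t ^+ 2) / c)); last first.
    rewrite lerD2l mulrAC ler_wpM2r ?invr_ge0 ?(ltW c0)// mulrDl.
    exact: lerD.
  (* Completing the squares; the rotation terms in be cancel between a and b. *)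
  have -> : dN t = - c * N t + (g t ^+ 2 + h t ^+ 2) / c -
      ((c * a t - g t) ^+ 2 + (c * b t - h t) ^+ 2) / c.
    by rewrite /dN /N /c; field; rewrite lt_eqF.
  by rewrite gerBl divr_ge0 ?(ltW c0)// addr_ge0 ?sqr_ge0.
pose Phi t := expR (c * t) * N t - M * expR ((c - d) * t).
pose dPhi t := expR (c * t) * (c * N t + dN t) - M * (c - d) * expR ((c - d) * t).
have isdPhi t : is_derive t (1 : R) Phi (dPhi t).
  rewrite /Phi; apply: is_derive_eq.
  by rewrite /dPhi /GRing.scale /=; ring.
have Phi_le t : 0 <= t -> Phi t <= Phi 0.
  move=> t0; apply: (@ler0_derive1_nincry R Phi 0) => //.
  - move=> x x0; rewrite derive1E derive_val /dPhi.
    have {}x0 : 0 <= x by move: x0; rewrite in_itv/= andbT => /ltW.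
    have -> : M * (c - d) = (K1 + K2) / c by rewrite divfK// subr_eq0 gt_eqF.
    have -> : (c - d) * x = c * x - d * x by rewrite mulrBl.
    rewrite expRD mulrCA -mulrBr pmulr_rle0 ?expR_gt0//.
    have := dNle x x0; rewrite mulNr; lra.
  - by apply: derivable_within_continuous.
have Nle t : 0 <= t -> N t <= (N 0 + M) * expR (- (d * t)).
  move=> t0; have := Phi_le t t0; rewrite /Phi !mulr0 expR0 mul1r mulr1.
  rewrite mulrBl expRD => P.
  have : N t <= M * expR (- (d * t)) + (N 0 - M) * expR (- (c * t)).
    have e0 := expR_gt0 (c * t).
    rewrite -(ler_pM2l e0) [leRHS]mulrDr [_ * (_ * expR (- (c * t)))]mulrCA.
    rewrite -expRD subrr expR0 mulr1 mulrCA; lra.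
  move=> /le_trans; apply; rewrite [leRHS]mulrDl addrC lerD2r.
  have N0 : 0 <= N 0 by rewrite /N addr_ge0 ?sqr_ge0.
  apply: (@le_trans _ _ (N 0 * expR (- (c * t)))).
    by rewrite ler_wpM2r ?expR_ge0// gerBl.
  by rewrite ler_wpM2l// ler_expR lerN2 ler_wpM2r// ltW.
have decay (f : R -> R) : (forall t, f t ^+ 2 <= N t) -> exp_decay f.
  (* The square root of the bound on N halves its rate. *)
  move=> fN; exists (Num.sqrt (N 0 + M)), (d / 2); split; first exact: divr_gt0.
  move=> t t0; rewrite -ler_sqr ?nnegrE ?mulr_ge0 ?sqrtr_ge0 ?expR_ge0//.
  rewrite real_normK ?num_real// (le_trans (fN t))// (le_trans (Nle t t0))//.
  rewrite exprMn sqr_sqrtr ?addr_ge0 ?sqr_ge0// -expRM_natl.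
  by rewrite (_ : 2%:R * _ = - (d * t))//; field.
by split; apply: decay => t; rewrite /N ?lerDl ?lerDr sqr_ge0.
Qed.

End DecayStep.

(** The fold equals P chi(A). It is kept as a fold because the decay induction strips the factors A
    - z one at a time. *)
Lemma foldl_char_poly_eq0 (F : fieldType) (n : nat) (A P : 'M[F]_n) (r : seq F) :
  char_poly A = \prod_(z <- r) ('X - z%:P) ->
  foldl (fun M z => M *m (A - z%:M)) P r = 0.
Proof.
case: n A P => [|n] A P rE; first by apply/matrixP => -[].
suff -> : foldl (fun M z => M *m (A - z%:M)) P r =
    P *m horner_mx A (\prod_(z <- r) ('X - z%:P)).
  by rewrite -rE Cayley_Hamilton mulmx0.
elim: r P {rE} => [|z r IH] P /=; first by rewrite big_nil rmorph1 mulmx1.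
rewrite IH big_cons rmorphM -mulmxE mulmxA rmorphB /= horner_mx_X.
by rewrite horner_mx_C.
Qed.

Section HurwitzDecay.
Variables (R : realType) (n : nat) (A : 'M[R]_n).

Local Notation E t := (expmx (t *: A)).
Local Notation ReM P := (map_mx (@complex.Re R) P).
Local Notation ImM P := (map_mx (@complex.Im R) P).

(** Real part of P A = z P + P (A - z), where A is real; with the imaginary part below it gives the
    coupled real system of [exp_decay_step]. *)
Let ReM_shift (P : 'M[R[i]]_n) (z : R[i]) : ReM P *m A =
  complex.Re z *: ReM P - complex.Im z *: ImM P + ReM (P *m (complexify A - z%:M)).
Proof.
rewrite mulmxBr mul_mx_scalar; apply/matrixP => i j; rewrite !mxE raddfB raddf_sum /=.
have -> : complex.Re (z * P i j) = complex.Re z * complex.Re (P i j) -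
    complex.Im z * complex.Im (P i j) by case: z (P i j) => ? ? [].
rewrite addrC subrK; apply: eq_bigr => k _; rewrite !mxE.
by case: (P i k) => u v /=; rewrite mulr0 subr0.
Qed.

Let ImM_shift (P : 'M[R[i]]_n) (z : R[i]) : ImM P *m A =
  complex.Im z *: ReM P + complex.Re z *: ImM P + ImM (P *m (complexify A - z%:M)).
Proof.
rewrite mulmxBr mul_mx_scalar; apply/matrixP => i j; rewrite !mxE raddfB raddf_sum /=.
have -> : complex.Im (z * P i j) = complex.Im z * complex.Re (P i j) +
    complex.Re z * complex.Im (P i j).
  by case: z (P i j) => ? ? [] u v /=; rewrite addrC.
rewrite addrC subrK; apply: eq_bigr => k _; rewrite !mxE.
by case: (P i k) => u v /=; rewrite mulr0 add0r.
Qed.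

(* Each factor A - z annihilated on the right is removed by [exp_decay_step]
   with eigenvalue z, since (d/dt - z) (P e^(tA)) = P (A - z) e^(tA). *)
Lemma exp_decay_annihilated (l : seq R[i]) (P : 'M[R[i]]_n) :
  (forall z, z \in l -> complex.Re z < 0) ->
  foldl (fun M z => M *m (complexify A - z%:M)) P l = 0 ->
  forall i j, exp_decay (fun t => (ReM P *m E t) i j) /\
              exp_decay (fun t => (ImM P *m E t) i j).
Proof.
elim: l P => [|z l IH] P /= lneg.
  move=> -> i j.
  have -> : ReM (0 : 'M[R[i]]_n) = 0 by apply/matrixP => ? ?; rewrite !mxE.
  have -> : ImM (0 : 'M[R[i]]_n) = 0 by apply/matrixP => ? ?; rewrite !mxE.
  by split; exists 0, 1; split => // t _; rewrite mul0mx mxE normr0 mul0r.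
move=> /(IH _ (fun w wl => lneg w (mem_behead (wl : w \in behead (z :: l))))) {}IH.
move=> i j; have [dg dh] := IH i j.
have dE (Q : 'M[R]_n) t : is_derive t (1 : R) (fun t => (Q *m E t) i j)
    ((Q *m A *m E t) i j).
  have := is_derive_mul_expmx A Q 1%:M t i j.
  rewrite mulmx1; congr (is_derive _ _ _ _).
  by apply/funext => s; rewrite mulmx1.
have combE (X Y Z : 'M[R]_n) (u v : R) :
    (u *: X + v *: Y + Z) i j = u * X i j + v * Y i j + Z i j by rewrite !mxE.
apply: (@exp_decay_step _ _ _ _ _ _ (complex.Im z) (lneg z (mem_head _ _)) _ _ dg dh) => t.
- have := dE (ReM P) t; rewrite (ReM_shift P z) -scaleNr !mulmxDl -!scalemxAl.
  by rewrite combE mulNr.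
- have := dE (ImM P) t; rewrite (ImM_shift P z) !mulmxDl -!scalemxAl.
  by rewrite combE.
Qed.

(** Over the complex numbers chi splits, its roots are eigenvalues and so have negative real part,
    and the product of all A - z is chi(A) = 0; a real P is its own real part. *)
Lemma exp_decay_mul_expmx (P : 'M[R]_n) i j :
  hurwitz A -> exp_decay (fun t => (P *m E t) i j).
Proof.
move=> hA.
have [r rE] := closed_field_poly_normal (char_poly (complexify A)).
move: rE; rewrite (monicP (char_poly_monic _)) scale1r => rE.
have rneg z : z \in r -> complex.Re z < 0.
  by move=> zr; apply: hA; rewrite eigenvalue_root_char rE root_prod_XsubC.
have [+ _] := exp_decay_annihilated rneg (foldl_char_poly_eq0 (complexify P) rE) i j.
congr exp_decay; apply/funext => t.
have -> : ReM (complexify P) = P; last by [].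
by apply/matrixP => k l; rewrite !mxE.
Qed.

End HurwitzDecay.

(** * Integration and square integrability on the half-line *)

Section HalfLine.
Variable R : realType.
Local Notation mu := (@lebesgue_measure R).
Local Notation H := (@halfline R : set (measurableTypeR R)).
Implicit Types f g : R -> R.

Lemma measurable_halfline : measurable H.
Proof. exact: measurable_itv. Qed.
Hint Resolve measurable_halfline : core.

Definition hl_integrable f := mu.-integrable H (EFin \o f).

Lemma hl_integrableD f g :
  hl_integrable f -> hl_integrable g -> hl_integrable (fun t => f t + g t).
Proof. by move=> hf hg; exact: (integrableD measurable_halfline hf hg). Qed.

Lemma hl_integrableZ (c : R) f :
  hl_integrable f -> hl_integrable (fun t => c * f t).
Proof. by move=> hf; exact: (integrableZl measurable_halfline c hf). Qed.

Lemma hl_integrable0 : hl_integrable (fun=> 0).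
Proof. exact: integrable0. Qed.

Lemma hl_integrable_sum (I : Type) (s : seq I) (h : I -> R -> R) :
  (forall i, hl_integrable (h i)) -> hl_integrable (fun t => \sum_(i <- s) h i t).
Proof.
move=> hh; elim: s => [|i s IH].
  by under eq_fun do rewrite big_nil; exact: hl_integrable0.
by under eq_fun do rewrite big_cons; exact: hl_integrableD.
Qed.

Lemma Rintegral_hl_sum (I : Type) (s : seq I) (h : I -> R -> R) :
  (forall i, hl_integrable (h i)) ->
  \int[mu]_(t in H) (\sum_(i <- s) h i t) = \sum_(i <- s) \int[mu]_(t in H) h i t.
Proof.
move=> hh; elim: s => [|i s IH].
  under eq_Rintegral do rewrite big_nil; rewrite big_nil.
  by rewrite Rintegral_cst// mul0r.
under eq_Rintegral do rewrite big_cons.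
rewrite big_cons RintegralD ?IH//; first exact: hh.
exact: hl_integrable_sum.
Qed.

(** Membership of the restriction in [Lfun] with exponent 2, by [sqintP], with measurability and
    integrability separated. *)
Definition sqint f := measurable_fun H f /\ hl_integrable (fun t => f t ^+ 2).

Lemma sqintP f : f \_ H \in Lfun mu 2%:E <-> sqint f.
Proof.
have sqE : (EFin \o (fun t => (f \_ H) t ^+ 2)) =
    (EFin \o (fun t => f t ^+ 2)) \_ H.
  by apply/funext => t /=; rewrite !patchE; case: ifP => // _; rewrite expr0n.
split=> [Lf|[mf intf]].
  split; last first.
    by apply/integrable_mkcond => //; rewrite -sqE; exact: Lfun2_integrable_sqr.
  move: Lf; rewrite inE => /andP[/[!inE] mf _].
  by have /(measurable_restrict f measurable_halfline measurableT) := mf;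
    rewrite setTI.
rewrite inE; apply/andP; split; rewrite inE /=.
  by apply/(measurable_restrict f measurable_halfline measurableT); rewrite setTI.
rewrite /finite_norm unlock /Lnorm /= poweR_lty//.
move/(integrable_mkcond _ measurable_halfline) : intf => /integrableP[_].
rewrite -sqE; apply: le_lt_trans; rewrite le_eqVlt; apply/orP; left; apply/eqP.
apply: eq_integral => t _ /=.
by rewrite normrX powR_mulrn.
Qed.

(** Domination of |f g| by f^2 + g^2, from the square of |f| - |g|. *)
Lemma sqint_mul_integrable f g :
  sqint f -> sqint g -> hl_integrable (fun t => f t * g t).
Proof.
move=> [mf f2] [mg g2]; apply: le_integrable (hl_integrableD f2 g2) => //.
  by apply/measurable_EFinP; exact: measurable_funM.
move=> t _ /=; rewrite lee_fin normrM [leRHS]ger0_norm ?addr_ge0 ?sqr_ge0//.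
rewrite -[_ ^+ 2]real_normK ?num_real// -[X in _ + X]real_normK ?num_real//.
have := sqr_ge0 (`|f t| - `|g t|); nra.
Qed.

Lemma sqintD f g : sqint f -> sqint g -> sqint (fun t => f t + g t).
Proof.
move=> sf sg; split; first exact: measurable_funD sf.1 sg.1.
have := hl_integrableD (hl_integrableD sf.2 sg.2)
  (hl_integrableZ 2 (sqint_mul_integrable sf sg)).
congr hl_integrable; apply/funext => t; ring.
Qed.

Lemma sqintZ (c : R) f : sqint f -> sqint (fun t => c * f t).
Proof.
move=> [mf f2]; split; first exact: measurable_funM.
by have := hl_integrableZ (c ^+ 2) f2; under eq_fun do rewrite -exprMn.
Qed.

Lemma sqint0 : sqint (fun=> 0).
Proof.
split => //.
by under eq_fun do rewrite expr0n; exact: hl_integrable0.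
Qed.

Lemma sqint_sum (I : Type) (s : seq I) (h : I -> R -> R) :
  (forall i, sqint (h i)) -> sqint (fun t => \sum_(i <- s) h i t).
Proof.
move=> hh; elim: s => [|i s IH].
  by under eq_fun do rewrite big_nil; exact: sqint0.
by under eq_fun do rewrite big_cons; exact: sqintD.
Qed.

Lemma Rintegral_sqr_eq0 f : sqint f -> \int[mu]_(t in H) (f t ^+ 2) = 0 ->
  f = (fun=> 0) %[ae mu in H].
Proof.
move=> [mf f2] int0.
have : (\int[mu]_(t in H) `|(f t ^+ 2)%:E| = 0)%E.
  under eq_integral => t _ do rewrite gee0_abs ?lee_fin ?sqr_ge0//.
  (* [fine] also sends infinite values to 0, so finiteness is needed to recover the extended
     integral from the real one. *)
  rewrite -(fineK (integrable_fin_num measurable_halfline f2)) /=.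
  by congr EFin.
move/(ae_eq_integral_abs _ measurable_halfline).
move=> /(_ (measurable_int _ f2)); apply: filterS => t /= ft /ft [] /eqP.
by rewrite sqrf_eq0 => /eqP.
Qed.

Lemma eq_ae_Rintegral f g : f = g %[ae mu in H] ->
  measurable_fun H f -> measurable_fun H g ->
  \int[mu]_(t in H) f t = \int[mu]_(t in H) g t.
Proof.
move=> fg mf mg; rewrite /Rintegral; congr fine.
apply: ae_eq_integral => //; [exact/measurable_EFinP|exact/measurable_EFinP|].
by apply: filterS fg => t /[apply] ->.
Qed.

Lemma derivative_measurable f (df : R -> R) :
  (forall t, is_derive t (1 : R) f (df t)) -> continuous f /\ measurable_fun H f.
Proof.
move=> d; have cf : continuous f.
  move=> t; apply/differentiable_continuous/derivable1_diffP.
  by case: (d t).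
split => //; apply: measurable_funS (continuous_measurable_fun cf) => //.
Qed.

Lemma cvg_expRMN (w : R) : 0 < w -> expR (- (w * t)) @[t --> +oo] --> (0 : R).
Proof.
move=> w0; rewrite (_ : (fun t => expR (- (w * t))) =
    (fun z => expR (- z)) \o (fun z => w * z))//.
apply: (@cvg_comp _ _ _ _ _ _ (pinfty_nbhs R)); last exact: cvgr_expR.
exact: gt0_cvgMry.
Qed.

Lemma exp_decay_cvg f : exp_decay f -> f t @[t --> +oo] --> (0 : R).
Proof.
move=> [K [w [w0 fK]]]; apply/norm_cvg0P.
apply: (@squeeze_cvgr _ _ _ _ (fun=> 0) (fun t => K * expR (- (w * t)))).
- near=> t; rewrite normr_ge0 fK//; near: t; exact: nbhs_pinfty_ge.
- exact: cvg_cst.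
- by rewrite -(mulr0 K); apply: cvgMl_tmp; exact: cvg_expRMN.
Unshelve. all: by end_near. Qed.

(** Nonnegativity lets the fundamental theorem hold up to infinity in the extended reals; the finite
    value - F(0) then yields integrability. *)
Lemma FTC_ge0_infty (F f : R -> R) : continuous f -> (forall t, 0 <= t -> 0 <= f t) ->
  (forall t, is_derive t (1 : R) F (f t)) -> F t @[t --> +oo] --> (0 : R) ->
  hl_integrable f /\ \int[mu]_(t in H) f t = - F 0.
Proof.
move=> cf f0 dF F0.
have cF : continuous F by case: (derivative_measurable dF).
have FTC : (\int[mu]_(t in H) (f t)%:E = 0%:E - (F 0)%:E)%E.
  apply: ge0_continuous_FTC2y => //.
  - exact: continuous_subspaceT.
  - by apply: cvg_at_right_filter; exact: cF.
  - by move=> t _; rewrite derive1E derive_val.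
split; last by rewrite /Rintegral FTC /= sub0r.
apply/integrableP; split.
  apply/measurable_EFinP; apply: measurable_funS (continuous_measurable_fun cf) => //.
under eq_integral => t.
  rewrite inE /halfline /= in_itv /= andbT => t0.
  rewrite ger0_norm ?f0//; over.
by rewrite FTC /= ltry.
Qed.

Lemma is_derive_expRMN (w K t : R) : w != 0 ->
  is_derive t (1 : R) (fun t => - (K / w) * expR (- (w * t)))
    (K * expR (- (w * t))).
Proof.
move=> w0; apply: is_derive_eq.
by rewrite /GRing.scale /=; field.
Qed.

Lemma continuous_expRMN (w : R) : continuous (fun t => expR (- (w * t))).
Proof.
by case: (@derivative_measurable (fun t => expR (- (w * t)))
  (fun t => - w * expR (- (w * t)))) => // t; apply: is_derive_eq;
  rewrite /GRing.scale /=; ring.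
Qed.

Lemma Rintegral_expRMN (w K : R) : 0 < w -> 0 <= K ->
  hl_integrable (fun t => K * expR (- (w * t))) /\
  \int[mu]_(t in H) (K * expR (- (w * t))) = K / w.
Proof.
move=> w0 K0; have [||t||hi ->] := @FTC_ge0_infty
  (fun t => - (K / w) * expR (- (w * t))) (fun t => K * expR (- (w * t))).
- by move=> t; apply: cvgMl_tmp; exact: continuous_expRMN.
- by move=> t _; rewrite mulr_ge0 ?expR_ge0.
- by apply: is_derive_expRMN; rewrite gt_eqF.
- by rewrite -(mulr0 (- (K / w))); apply: cvgMl_tmp; exact: cvg_expRMN.
- by split => //; rewrite mulr0 oppr0 expR0 mulr1 opprK.
Qed.

Lemma exp_decay_integrable f :
  measurable_fun H f -> exp_decay f -> hl_integrable f.
Proof.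
move=> mf [K [w [w0 fK]]].
have K0 : 0 <= K by have := fK 0 (lexx _); rewrite mulr0 oppr0 expR0 mulr1; exact: le_trans.
have [ei _] := Rintegral_expRMN w0 K0.
apply: le_integrable ei => //; first exact/measurable_EFinP.
move=> t; rewrite /halfline /= in_itv /= andbT => t0; rewrite lee_fin.
by rewrite [leRHS]ger0_norm ?fK// mulr_ge0// expR_ge0.
Qed.

Lemma exp_decay_sqint f : measurable_fun H f -> exp_decay f -> sqint f.
Proof.
move=> mf ef; split => //; have [L [w [L0 w0 fL]]] := exp_decay_sqr ef.
apply: exp_decay_integrable; first exact: measurable_funX.
by exists L, w; split => // t t0; rewrite ger0_norm ?sqr_ge0// fL.
Qed.

(* Adding a multiple of a decaying exponential makes the integrand nonnegative. *)
Lemma FTC_exp_decay (F f : R -> R) : continuous f ->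
  (forall t, is_derive t (1 : R) F (f t)) -> exp_decay F -> exp_decay f ->
  \int[mu]_(t in H) f t = - F 0.
Proof.
move=> cf dF eF ef; have [K [w [w0 fK]]] := ef.
have K0 : 0 <= K by have := fK 0 (lexx _); rewrite mulr0 oppr0 expR0 mulr1; exact: le_trans.
have mf : measurable_fun H f.
  by apply: measurable_funS (continuous_measurable_fun cf).
have fi := exp_decay_integrable mf ef.
have [ei eE] := Rintegral_expRMN w0 K0.
have [||t||_] := @FTC_ge0_infty
  (fun t => F t + - (K / w) * expR (- (w * t))) (fun t => f t + K * expR (- (w * t))).
- move=> t; apply: cvgD; first exact: cf.
  by apply: cvgMl_tmp; exact: continuous_expRMN.
- by move=> t t0; have := fK t t0; rewrite ler_norml => /andP[+ _]; rewrite -subr_ge0 opprK.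
- by apply: is_deriveD; apply: is_derive_expRMN; rewrite gt_eqF.
- rewrite -[X in _ --> X]addr0 -[X in _ + X](mulr0 (- (K / w))).
  apply: cvgD; first exact: exp_decay_cvg.
  by apply: cvgMl_tmp; exact: cvg_expRMN.
rewrite RintegralD// eE mulr0 oppr0 expR0 mulr1 opprD opprK.
by move/addIr.
Qed.

End HalfLine.

(** * Integrals of matrix functions and the inner product of L_2 *)

Section MatrixIntegral.
Variable R : realType.
Local Notation mu := (@lebesgue_measure R).
Local Notation H := (@halfline R : set (measurableTypeR R)).

Lemma ae_halflineS (P Q : R -> Prop) : (forall t, P t -> Q t) ->
  (\forall t \ae mu, H t -> P t) -> (\forall t \ae mu, H t -> Q t).
Proof.
move=> PQ; apply: (@filterS _ _ (ae_filter_ringOfSetsType mu)) => t HP Ht.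
exact/PQ/HP.
Qed.

Definition mx_integrable (p q : nat) (F : R -> 'M[R]_(p, q)) : Prop :=
  forall i j, hl_integrable (fun t => F t i j).

Definition mx_sqint (p q : nat) (F : R -> 'M[R]_(p, q)) : Prop :=
  forall i j, sqint (fun t => F t i j).

Definition mx_integral (p q : nat) (F : R -> 'M[R]_(p, q)) : 'M[R]_(p, q) :=
  \matrix_(i, j) \int[mu]_(t in H) F t i j.

Lemma L2P (m : nat) (f : R -> 'cV[R]_m) : L2 f <-> mx_sqint f.
Proof.
split=> hf i => [j|]; first by rewrite (ord1 j); apply/sqintP; exact: hf.
by apply/sqintP; exact: hf.
Qed.

Lemma mx_integrable_mull (p q r : nat) (P : 'M[R]_(p, q)) (F : R -> 'M[R]_(q, r)) :
  mx_integrable F -> mx_integrable (fun t => P *m F t).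
Proof.
move=> hF i j; under eq_fun do rewrite mxE.
by apply: hl_integrable_sum => k; exact: hl_integrableZ.
Qed.

Lemma mx_integral_mull (p q r : nat) (P : 'M[R]_(p, q)) (F : R -> 'M[R]_(q, r)) :
  mx_integrable F -> mx_integral (fun t => P *m F t) = P *m mx_integral F.
Proof.
move=> hF; apply/matrixP => i j; rewrite !mxE.
under eq_Rintegral do rewrite mxE.
rewrite Rintegral_hl_sum => [|k]; last exact: hl_integrableZ.
apply: eq_bigr => k _; rewrite RintegralZl ?mxE//; last exact: hF.
exact: measurable_halfline.
Qed.

Lemma mx_integral_tr (p q : nat) (F : R -> 'M[R]_(p, q)) :
  mx_integral (fun t => (F t)^T) = (mx_integral F)^T.
Proof. by apply/matrixP => i j; rewrite !mxE; under eq_Rintegral do rewrite mxE. Qed.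

Lemma mx_integrable_tr (p q : nat) (F : R -> 'M[R]_(p, q)) :
  mx_integrable F -> mx_integrable (fun t => (F t)^T).
Proof. by move=> hF i j; under eq_fun do rewrite mxE; exact: hF. Qed.

Lemma mx_integral_mulr (p q r : nat) (F : R -> 'M[R]_(p, q)) (P : 'M[R]_(q, r)) :
  mx_integrable F -> mx_integral (fun t => F t *m P) = mx_integral F *m P.
Proof.
move=> hF; apply: trmx_inj; rewrite -mx_integral_tr trmx_mul -mx_integral_tr.
rewrite -mx_integral_mull; last exact: mx_integrable_tr.
by congr mx_integral; apply/funext => t; rewrite trmx_mul.
Qed.

Lemma mx_integrable_mul (p q r : nat) (F : R -> 'M[R]_(p, q))
    (G : R -> 'M[R]_(q, r)) :
  mx_sqint F -> mx_sqint G -> mx_integrable (fun t => F t *m G t).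
Proof.
move=> hF hG i j; under eq_fun do rewrite mxE.
by apply: hl_integrable_sum => k; exact: sqint_mul_integrable.
Qed.

Lemma mx_sqint_tr (p q : nat) (F : R -> 'M[R]_(p, q)) :
  mx_sqint F -> mx_sqint (fun t => (F t)^T).
Proof. by move=> hF i j; under eq_fun do rewrite mxE; exact: hF. Qed.

Lemma mx_sqint_mull (p q r : nat) (P : 'M[R]_(p, q)) (F : R -> 'M[R]_(q, r)) :
  mx_sqint F -> mx_sqint (fun t => P *m F t).
Proof.
move=> hF i j; under eq_fun do rewrite mxE.
by apply: sqint_sum => k; exact: sqintZ.
Qed.

Lemma mx_sqint_mulr (p q r : nat) (F : R -> 'M[R]_(p, q)) (P : 'M[R]_(q, r)) :
  mx_sqint F -> mx_sqint (fun t => F t *m P).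
Proof.
move=> /mx_sqint_tr /(mx_sqint_mull P^T) /mx_sqint_tr.
by congr mx_sqint; apply/funext => t; rewrite trmx_mul !trmxK.
Qed.

Lemma mx_sqintD (p q : nat) (F G : R -> 'M[R]_(p, q)) :
  mx_sqint F -> mx_sqint G -> mx_sqint (fun t => F t + G t).
Proof. by move=> hF hG i j; under eq_fun do rewrite mxE; exact: sqintD. Qed.

Lemma mx_sqintZ (p q : nat) (c : R) (F : R -> 'M[R]_(p, q)) :
  mx_sqint F -> mx_sqint (fun t => c *: F t).
Proof. by move=> hF i j; under eq_fun do rewrite mxE; exact: sqintZ. Qed.

Lemma mx_sqint0 (p q : nat) : mx_sqint (fun=> 0 : 'M[R]_(p, q)).
Proof. by move=> i j; under eq_fun do rewrite mxE; exact: sqint0. Qed.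

Lemma mx_integralD (p q : nat) (F G : R -> 'M[R]_(p, q)) :
  mx_integrable F -> mx_integrable G ->
  mx_integral (fun t => F t + G t) = mx_integral F + mx_integral G.
Proof.
move=> hF hG; apply/matrixP => i j; rewrite !mxE.
under eq_Rintegral do rewrite mxE.
by rewrite RintegralD//; [exact: measurable_halfline|exact: hF|exact: hG].
Qed.

Lemma mx_integralZ (p q : nat) (c : R) (F : R -> 'M[R]_(p, q)) :
  mx_integrable F -> mx_integral (fun t => c *: F t) = c *: mx_integral F.
Proof.
move=> hF; apply/matrixP => i j; rewrite !mxE.
under eq_Rintegral do rewrite mxE.
by rewrite RintegralZl//; [exact: measurable_halfline|exact: hF].
Qed.

Lemma eq_ae_mx_integral (p q : nat) (F G : R -> 'M[R]_(p, q)) :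
  F = G %[ae mu in H] -> mx_integrable F -> mx_integrable G ->
  mx_integral F = mx_integral G.
Proof.
move=> FG hF hG; apply/matrixP => i j; rewrite !mxE.
apply: eq_ae_Rintegral; first by apply: ae_halflineS FG => t ->.
- by apply/measurable_EFinP; exact: measurable_int (hF i j).
- by apply/measurable_EFinP; exact: measurable_int (hG i j).
Qed.

Lemma L2inner_mx_integral (m : nat) (f g : R -> 'cV[R]_m) :
  L2inner f g = mx_integral (fun t => (f t)^T *m g t) 0 0.
Proof. by rewrite mxE. Qed.

Lemma L2_integrable (m : nat) (f g : R -> 'cV[R]_m) : L2 f -> L2 g ->
  mx_integrable (fun t => (f t)^T *m g t).
Proof. by move=> /L2P hf /L2P hg; apply: mx_integrable_mul => //; exact: mx_sqint_tr. Qed.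

Lemma L2innerC (m : nat) (f g : R -> 'cV[R]_m) : L2inner f g = L2inner g f.
Proof.
rewrite !L2inner_mx_integral -[in RHS](trmxK (mx_integral _)) -mx_integral_tr.
rewrite [RHS]mxE; congr (fun_of_matrix (mx_integral _) 0 0); apply/funext => t.
by rewrite trmx_mul trmxK.
Qed.

Lemma L2innerDr (m : nat) (f g h : R -> 'cV[R]_m) : L2 f -> L2 g -> L2 h ->
  L2inner f (fun t => g t + h t) = L2inner f g + L2inner f h.
Proof.
move=> hf hg hh; rewrite !L2inner_mx_integral.
under [in LHS]eq_fun do rewrite mulmxDr.
by rewrite mx_integralD ?[LHS]mxE//; exact: L2_integrable.
Qed.

Lemma L2innerZr (m : nat) (c : R) (f g : R -> 'cV[R]_m) : L2 f -> L2 g ->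
  L2inner f (fun t => c *: g t) = c * L2inner f g.
Proof.
move=> hf hg; rewrite !L2inner_mx_integral.
under [in LHS]eq_fun do rewrite -scalemxAr.
by rewrite mx_integralZ ?[LHS]mxE//; exact: L2_integrable.
Qed.

Lemma eq_L2innerr (m : nat) (f g h : R -> 'cV[R]_m) : L2 f -> L2 g -> L2 h ->
  L2eq g h -> L2inner f g = L2inner f h.
Proof.
move=> hf hg hh gh; rewrite !L2inner_mx_integral; congr (_ _ 0 0).
apply: eq_ae_mx_integral; [|exact: L2_integrable|exact: L2_integrable].
by apply: ae_halflineS gh => t ->.
Qed.

Lemma L2D (m : nat) (f g : R -> 'cV[R]_m) :
  L2 f -> L2 g -> L2 (fun t => f t + g t).
Proof. by move=> /L2P hf /L2P hg; apply/L2P; exact: mx_sqintD. Qed.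

Lemma L2Z (m : nat) (c : R) (f : R -> 'cV[R]_m) : L2 f -> L2 (fun t => c *: f t).
Proof. by move=> /L2P hf; apply/L2P; exact: mx_sqintZ. Qed.

Lemma L20 (m : nat) : L2 (fun=> 0 : 'cV[R]_m).
Proof. by apply/L2P; exact: mx_sqint0. Qed.

(** Testing against the difference d = f - g gives a zero norm; its square is a sum of integrals of
    squared coordinates, so each of the finitely many coordinates vanishes almost everywhere. *)
Lemma L2_nondegenerate (m : nat) (f g : R -> 'cV[R]_m) : L2 f -> L2 g ->
  (forall h, L2 h -> L2inner h f = L2inner h g) -> L2eq f g.
Proof.
move=> hf hg fg; pose d t := f t + (-1) *: g t.
have hd : L2 d by apply: L2D => //; exact: L2Z.
have dd : L2inner d d = 0.
  have hg' : L2 (fun t => (-1) *: g t) by exact: L2Z.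
  rewrite (L2innerDr hd hf hg') (L2innerZr _ hd hg) (fg d hd) mulN1r; exact: subrr.
have sqd i : sqint (fun t => d t i 0) by move/L2P: hd; apply.
have sum0 : \sum_i \int[mu]_(t in H) (d t i 0 ^+ 2) = 0.
  rewrite -Rintegral_hl_sum => [|i]; last exact: (sqd i).2.
  rewrite -[RHS]dd; apply: eq_Rintegral => t _.
  by rewrite [RHS]mxE; apply: eq_bigr => i _; rewrite [X in _ = X * _]mxE expr2.
have d0 i : \forall t \ae mu, H t -> d t i 0 = 0.
  apply: Rintegral_sqr_eq0 => //; apply/eqP.
  have := @psumr_eq0P R _ predT (fun i => \int[mu]_(t in H) (d t i 0 ^+ 2)).
  by move=> ->// k _; apply: Rintegral_ge0 => t _; exact: sqr_ge0.
have : \forall t \ae mu, H t -> forall i, d t i 0 = 0.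
  have : \forall t \ae mu, forall i, H t -> d t i 0 = 0.
    exact: (@filter_forall _ _ _ _ (ae_filter_ringOfSetsType mu)).
  by apply: (@filterS _ _ (ae_filter_ringOfSetsType mu)) => t dt Ht i; exact: dt.
apply: ae_halflineS => t dt; apply/colP => i; have := dt i.
by rewrite /d !mxE mulN1r => /eqP; rewrite subr_eq0 => /eqP.
Qed.

End MatrixIntegral.

(** * The Hankel operator and its bilinear form *)

Section Hankel.
Variables (R : realType) (n m : nat) (A : 'M[R]_n) (B : 'M[R]_(n, m)).
Variables (C : 'M[R]_(m, n)) (sigma : 'M[R]_m).
Hypothesis hA : hurwitz A.
Hypothesis hsigma : is_signature sigma.
Local Notation H := (@halfline R : set (measurableTypeR R)).

Local Notation E t := (expmx (t *: A)).

(** The state x_0 at time 0 produced by the time-reversed past input [u]. *)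
Definition reached_state (u : R -> 'cV[R]_m) : 'cV[R]_n :=
  mx_integral (fun tau => E tau *m B *m u tau).

Definition signed_output (u : R -> 'cV[R]_m) (t : R) : 'cV[R]_m :=
  sigma *m hankel A B C u t.

Let exp_decay_E i j : exp_decay (fun t => E t i j).
Proof.
have := exp_decay_mul_expmx 1%:M i j hA.
by congr exp_decay; apply/funext => t; rewrite mul1mx.
Qed.

Let measurable_E i j : measurable_fun H (fun t => E t i j).
Proof. by case: (derivative_measurable (fun t => is_derive_expmx A t i j)). Qed.

Lemma mx_sqint_expmx : mx_sqint (fun t => E t).
Proof. by move=> i j; exact: exp_decay_sqint. Qed.

Let integrable_EB u : L2 u -> mx_integrable (fun tau => E tau *m B *m u tau).
Proof.
move=> /L2P hu; apply: mx_integrable_mul => //.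
exact/mx_sqint_mulr/mx_sqint_expmx.
Qed.

(** The semigroup law pulls e^(tA) out of the integral over tau, so the Hankel operator factors
    through the state space. *)
Lemma signed_outputE u t : L2 u ->
  signed_output u t = sigma *m C *m E t *m reached_state u.
Proof.
move=> hu; rewrite /signed_output -!mulmxA; congr (_ *m _).
rewrite mulmxA /reached_state -mx_integral_mull; last exact: integrable_EB.
apply/colP => i; rewrite !mxE; apply: eq_Rintegral => tau _.
by rewrite expmxD !mulmxA.
Qed.

Lemma L2_signed_output u : L2 u -> L2 (signed_output u).
Proof.
move=> hu; apply/L2P.
have := mx_sqint_mulr (reached_state u) (mx_sqint_mull (sigma *m C) mx_sqint_expmx).
by congr mx_sqint; apply/funext => t; rewrite signed_outputE.
Qed.

Lemma reached_stateD c u v : L2 u -> L2 v ->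
  reached_state (fun t => c *: u t + v t) = c *: reached_state u + reached_state v.
Proof.
move=> hu hv; rewrite /reached_state -mx_integralZ; last exact: integrable_EB.
rewrite -mx_integralD; last exact: integrable_EB.
  by congr mx_integral; apply/funext => t; rewrite mulmxDr -scalemxAr.
move=> i j; under eq_fun do rewrite mxE.
exact/hl_integrableZ/integrable_EB.
Qed.

Lemma signed_outputD c u v t : L2 u -> L2 v ->
  signed_output (fun s => c *: u s + v s) t =
  c *: signed_output u t + signed_output v t.
Proof.
move=> hu hv; rewrite !signed_outputE//; last by apply: L2D => //; exact: L2Z.
by rewrite reached_stateD// mulmxDr scalemxAr.
Qed.

(** Equality holds at every t, not just almost everywhere, because the output depends on the input
    only through the reached state. *)
Lemma eq_signed_output u v : L2 u -> L2 v -> L2eq u v ->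
  signed_output u = signed_output v.
Proof.
move=> hu hv uv; apply/funext => t; rewrite !signed_outputE//; congr (_ *m _).
apply: eq_ae_mx_integral; [|exact: integrable_EB|exact: integrable_EB].
by apply: ae_halflineS uv => s ->.
Qed.

(** The transpose of the adjoint, applied to v, of the map sending x to the output sigma C e^(tA)
    x. *)
Definition observed_costate (v : R -> 'cV[R]_m) : 'rV[R]_n :=
  mx_integral (fun t => (v t)^T *m (sigma *m C *m E t)).

Let integrable_CE v : L2 v ->
  mx_integrable (fun t => (v t)^T *m (sigma *m C *m E t)).
Proof.
move=> /L2P hv; apply: mx_integrable_mul; first exact: mx_sqint_tr.
exact/mx_sqint_mull/mx_sqint_expmx.
Qed.

Lemma L2inner_signed_output v u : L2 v -> L2 u ->
  L2inner v (signed_output u) = (observed_costate v *m reached_state u) 0 0.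
Proof.
move=> hv hu; rewrite L2inner_mx_integral -mx_integral_mulr; last exact: integrable_CE.
by congr (fun_of_matrix (mx_integral _) 0 0); apply/funext => t;
  rewrite signed_outputE// !mulmxA.
Qed.

Lemma markov_impulse_sym : markov_symmetric A B C sigma -> forall r,
  (sigma *m C *m E r *m B)^T = sigma *m C *m E r *m B.
Proof.
move=> hM r; apply/matrixP => i j; rewrite mxE.
have /cvg_lim <- // := @expmx_pseries _ _ A _ _ (sigma *m C) B r i j.
have /cvg_lim <- // := @expmx_pseries _ _ A _ _ (sigma *m C) B r j i.
congr (limn (pseries _ _)); apply/funext => k; rewrite /expmx_coef.
by have /matrixP/(_ i j) := hM k; rewrite mxE => ->.
Qed.

(* Both sides equal the double integral of the symmetric kernel; as the matrices
   pulled out of the inner integral are constant, Fubini is not needed. *)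
Lemma markov_hankel_sym : markov_symmetric A B C sigma ->
  forall u v, L2 u -> L2 v ->
  L2inner v (signed_output u) = L2inner u (signed_output v).
Proof.
move=> hM u v hu hv; rewrite [RHS]L2inner_signed_output//.
rewrite L2inner_mx_integral -mx_integral_mull; last exact: integrable_EB.
congr (fun_of_matrix (mx_integral _) 0 0); apply/funext => t.
rewrite signed_outputE// mulmxA -mx_integral_mull; last exact: integrable_EB.
rewrite -mx_integral_mulr; last exact: integrable_CE.
(* The integrands are 1 by 1 and equal their transposes; transposing exchanges u and v around the
   symmetric kernel. *)
have scalar_tr (M : 'M[R]_1) : M = M^T.
  by apply/matrixP => i j; rewrite mxE (ord1 i) (ord1 j).
rewrite [LHS]scalar_tr -mx_integral_tr; congr mx_integral; apply/funext => tau.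
have -> : (v t)^T *m (sigma *m C *m E t) *m (E tau *m B *m u tau) =
    (v t)^T *m (sigma *m C *m E (t + tau) *m B *m u tau).
  by rewrite expmxD !mulmxA.
rewrite trmx_mul trmxK [(_ *m u tau)^T]trmx_mul markov_impulse_sym//.
by rewrite addrC expmxD !mulmxA.
Qed.

Let exp_decay_expRM l (g : R -> R) : 0 <= l ->
  exp_decay g -> exp_decay (fun t => expR (- (l * t)) * g t).
Proof.
move=> l0 [K [w [w0 gK]]]; exists K, w; split => // t t0.
rewrite normrM ger0_norm ?expR_ge0// (le_trans _ (gK t t0))//.
by rewrite ler_piMl// -expR0 ler_expR oppr_le0 mulr_ge0.
Qed.

Let exp_decay_expR l : 0 < l -> exp_decay (fun t : R => expR (- (l * t))).
Proof.
by move=> l0; exists 1, l; split => // t _; rewrite mul1r ger0_norm// expR_ge0.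
Qed.

Let sqint_expR l : 0 < l -> sqint (fun t : R => expR (- (l * t))).
Proof.
move=> l0; apply: exp_decay_sqint; last exact: exp_decay_expR.
exact: measurable_funS (continuous_measurable_fun (@continuous_expRMN _ l)).
Qed.

Let integrable_expR_E l : 0 < l -> mx_integrable (fun t => expR (- (l * t)) *: E t).
Proof.
move=> l0 i j; under eq_fun do rewrite mxE.
by apply: sqint_mul_integrable; [exact: sqint_expR|exact: mx_sqint_expmx].
Qed.

(** The Laplace transform of e^(tA): (l - A) e^(-lt) e^(tA) is the derivative of - e^(-lt) e^(tA),
    which decays at infinity and equals -1 at t = 0, so its integral is the identity. *)
Lemma laplace_expmx l : 0 < l ->
  mx_integral (fun t => expR (- (l * t)) *: E t) = invmx (l%:M - A).
Proof.
move=> l0; have ul : l%:M - A \in unitmx by apply: hurwitz_unitmx => //; exact: ltW.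
suff lX : (l%:M - A) *m mx_integral (fun t => expR (- (l * t)) *: E t) = 1%:M.
  by rewrite -[LHS](mulKmx ul) lX mulmx1.
rewrite -mx_integral_mull; last exact: integrable_expR_E.
apply/matrixP => i j; rewrite mxE.
pose F t := - (expR (- (l * t)) * E t i j).
pose f t := expR (- (l * t)) * ((l%:M - A) *m E t) i j.
rewrite (_ : (fun t => _) = f); last first.
  by apply/funext => t; rewrite -scalemxAr mxE.
have dF t : is_derive t (1 : R) F (f t).
  have dE := is_derive_expmx A t i j; rewrite /F; apply: is_derive_eq.
  rewrite /f mulmxBl mul_scalar_mx !mxE /GRing.scale /=.
  ring.
have [cf _] : continuous f /\ measurable_fun H f.
  apply: (@derivative_measurable _ f (fun t => - l * expR (- (l * t)) *
    ((l%:M - A) *m E t) i j + expR (- (l * t)) * ((l%:M - A) *m A *m E t) i j)) => t.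
  have dE := is_derive_mul_expmx A (l%:M - A) 1%:M t i j.
  move: dE; rewrite mulmx1 (_ : (fun s => _) = (fun s => ((l%:M - A) *m E s) i j)) => [dE|].
    by rewrite /f; apply: is_derive_eq; rewrite /GRing.scale /=; ring.
  by apply/funext => s; rewrite mulmx1.
rewrite (FTC_exp_decay cf dF).
- by rewrite /F mulr0 oppr0 expR0 mul1r opprK expmx0.
- have [K [w [w0 EK]]] := exp_decay_expRM (ltW l0) (exp_decay_E i j).
  by exists K, w; split => // t t0; rewrite normrN EK.
- by apply: exp_decay_expRM; [exact: ltW|exact: exp_decay_mul_expmx].
Qed.

Let test_input l (i : 'I_m) (t : R) : 'cV[R]_m := expR (- (l * t)) *: delta_mx i 0.

Let L2_test_input l i : 0 < l -> L2 (test_input l i).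
Proof.
move=> l0; apply/L2P => k j; rewrite /test_input.
by under eq_fun do rewrite mxE mulrC; exact/sqintZ/sqint_expR.
Qed.

(* Exponential test inputs e^(-l t), e^(-k t) turn the symmetry of the Hankel form
   into that of sigma C (k - A)^-1 (l - A)^-1 B, hence by the resolvent identity
   the antisymmetric part of sigma C (l - A)^-1 B does not depend on l. *)
Lemma hankel_sym_markov : (forall u v, L2 u -> L2 v ->
  L2inner v (signed_output u) = L2inner u (signed_output v)) ->
  markov_symmetric A B C sigma.
Proof.
move=> sym k; apply/matrixP => i j; rewrite mxE; apply/esym/eqP.
rewrite -subr_eq0; apply/eqP.
have form p q a b : 0 < p -> 0 < q ->
    L2inner (test_input p a) (signed_output (test_input q b)) =
    (sigma *m C *m (invmx (p%:M - A) *m invmx (q%:M - A)) *m B) a b.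
  move=> p0 q0; rewrite L2inner_signed_output; [|exact: L2_test_input..].
  have -> : reached_state (test_input q b) = invmx (q%:M - A) *m col b B.
    rewrite -laplace_expmx// -mx_integral_mulr; last exact: integrable_expR_E.
    congr mx_integral; apply/funext => t.
    by rewrite /test_input -scalemxAr -scalemxAl colE -mulmxA.
  have -> : observed_costate (test_input p a) =
      row a (sigma *m C) *m invmx (p%:M - A).
    rewrite -laplace_expmx// -mx_integral_mull; last exact: integrable_expR_E.
    congr mx_integral; apply/funext => t.
    rewrite /test_input linearZ /= trmx_delta -scalemxAl -scalemxAr rowE.
    by rewrite !mulmxA.
  set P := sigma *m C; set X := invmx _; set Y := invmx _.
  have -> : row a P *m X *m (Y *m col b B) = col b (row a (P *m (X *m Y) *m B)).
    by rewrite !rowE !colE !mulmxA.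
  by rewrite mxE [LHS]mxE.
(* The points start at 1 because the exponential inputs are in L_2 only for positive rates. *)
have inj : injective (fun N : nat => N.+1%:R : R).
  by move=> a b /eqP; rewrite eqr_nat eqSS => /eqP.
have ug l : 0 < l -> l%:M - A \in unitmx.
  by move=> l0; apply: hurwitz_unitmx => //; exact: ltW.
apply: (@resolvent_const_expr_eq0 _ _ _ _ k (antisym_entry (sigma *m C) B i j)
  (antisym_entry (sigma *m C) B i j (invmx (1%:M - A))) inj) => N.
  exact: ug.
have l0 : 0 < N.+1%:R :> R by [].
move: N.+1%:R l0 => l l0.
apply/eqP; rewrite -subr_eq0 -linearB resolvent_identity ?ug//.
(* Exchanging the two inputs swaps the indices and the two resolvents; since resolvents commute,
   only the indices end up swapped. *)
rewrite linearZ /= /antisym_entry -form// sym; [|exact: L2_test_input..].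
rewrite form// resolvent_comm ?ug// subrr.
by apply/eqP; exact: mulr0.
Qed.

End Hankel.

(** * The graph as a Lagrangian subspace and its generating functional *)

Section HankelGraph.
Variables (R : realType) (n m : nat) (A : 'M[R]_n) (B : 'M[R]_(n, m)).
Variables (C : 'M[R]_(m, n)) (sigma : 'M[R]_m).
Hypothesis hA : hurwitz A.

Local Notation S := (hankel_graph A B C sigma).
Local Notation Y := (signed_output A B C sigma).

Definition hankel_form_sym : Prop :=
  forall u v, L2 u -> L2 v -> L2inner v (Y u) = L2inner u (Y v).

Let L2Y u : L2 u -> L2 (Y u).
Proof. exact: L2_signed_output. Qed.

Lemma symplectic_formE (a b : L2pair R m) :
  L2 a.1 -> L2 a.2 -> L2 b.1 -> L2 b.2 ->
  symplectic_form a b = L2inner b.1 a.2 - L2inner a.1 b.2.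
Proof.
move=> a1 a2 b1 b2; rewrite /symplectic_form RintegralB//.
- exact: measurable_halfline.
- exact: L2_integrable.
- exact: L2_integrable.
Qed.

Lemma hankel_graph_signed_output u : L2 u -> S (u, Y u).
Proof. by move=> hu; split => //=; [exact: L2Y|exact: aeW]. Qed.

Lemma hankel_graph_subspace : linear_subspace S.
Proof.
split.
- by move=> a [].
- move=> a b [a1 a2 a12] b1 b2 ab1 ab2; split => //.
  rewrite -[X in L2eq _ X](eq_signed_output B C sigma hA a1 b1 ab1).
  by apply: ae_eq_trans (ae_eq_sym ab2) _.
- split => /=; [exact: L20|exact: L20|].
  (* Zero is written as -1 * 0 + 0 so that linearity gives - Y(0) + Y(0) = 0. *)
  apply: aeW => t _; transitivity (Y (fun=> -1 *: 0 + 0) t).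
    by rewrite (signed_outputD _ _ _ hA _ _ (@L20 R m) (@L20 R m)) scaleN1r addNr.
  by rewrite scaler0 addr0.
- move=> c a b [a1 a2 a12] [b1 b2 b12]; split => /=.
  + by apply: L2D => //; exact: L2Z.
  + by apply: L2D => //; exact: L2Z.
  + move: a12 b12; apply: (@filterS2 _ _ (ae_filter_ringOfSetsType (@lebesgue_measure R))).
    move=> t at2 bt2 Ht; rewrite at2// bt2//.
    by rewrite -[RHS]/(Y _ t) signed_outputD.
Qed.

(** The symplectic form of two graph points is the antisymmetric part of the Hankel form, so
    symmetry is isotropy. It also gives maximality: if (f, e) is orthogonal to the graph, then <h,
    e> = <f, Y h> = <h, Y f> for all h, and nondegeneracy gives e = Y f. *)
Lemma lagrangian_hankel_graph : lagrangian S <-> hankel_form_sym.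
Proof.
split=> [[_ SE] u v hu hv|sym].
  have : orthogonal_companion S (u, Y u) by rewrite -SE; exact: hankel_graph_signed_output.
  move=> [_ _ /(_ _ (hankel_graph_signed_output hv))].
  rewrite (@symplectic_formE (u, Y u) (v, Y v) hu (L2Y hu) hv (L2Y hv)).
  by move/eqP; rewrite subr_eq0 => /eqP.
split; first exact: hankel_graph_subspace.
apply/seteqP; split=> a.
  move=> [a1 a2 a12]; split=> // b [b1 b2 b12]; rewrite symplectic_formE//.
  rewrite (eq_L2innerr b1 a2 (L2Y a1) a12) (eq_L2innerr a1 b2 (L2Y b1) b12).
  by rewrite sym// subrr.
move=> [a1 a2 aS]; split => //.
apply: (L2_nondegenerate a2 (L2Y a1)) => h hh; rewrite sym//.
have := aS _ (hankel_graph_signed_output hh).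
rewrite (@symplectic_formE a (h, Y h) a1 a2 hh (L2Y hh)).
by move/eqP; rewrite subr_eq0 => /eqP.
Qed.

Local Notation V := (hankel_functional A B C sigma).

(** By symmetry the two cross terms coincide, and together they absorb the factor 1/2. *)
Lemma hankel_functional_expand f h : hankel_form_sym -> L2 f -> L2 h ->
  forall eps : R, V (fun t => f t + eps *: h t) =
  V f + eps * L2inner (Y f) h + eps ^+ 2 * V h.
Proof.
move=> sym hf hh eps; rewrite /hankel_functional -!/(Y _).
have heh : L2 (fun t => eps *: h t) by exact: L2Z.
have -> : Y (fun t => f t + eps *: h t) = (fun t => Y f t + eps *: Y h t).
  apply/funext => t; rewrite [RHS]addrC -signed_outputD//.
  by congr (signed_output _ _ _ _ _ _); apply/funext => s; rewrite addrC.
have heY : L2 (fun t => eps *: Y h t) by apply/L2Z/L2Y.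
rewrite L2innerDr; [|exact: L2D|exact: L2Y|exact: heY].
rewrite L2innerZr; [|exact: L2D|exact: L2Y].
rewrite ![L2inner (fun t => f t + _) _]L2innerC.
rewrite !L2innerDr//; try exact: L2Y.
rewrite !L2innerZr//; try exact: L2Y.
rewrite !(L2innerC (Y _)) (sym h f)//.
by move: (L2inner f (Y f)) (L2inner f (Y h)) (L2inner h (Y h)) => x y z; field.
Qed.

Lemma is_derive_hankel_functional f h : hankel_form_sym -> L2 f -> L2 h ->
  is_derive (0 : R) (1 : R) (fun eps : R => V (fun t => f t + eps *: h t))
    (L2inner (Y f) h).
Proof.
move=> sym hf hh; under eq_fun do rewrite hankel_functional_expand//.
apply: is_derive_eq; rewrite /GRing.scale /=.
by ring.
Qed.

(** The expansion shows that Y f is a gradient at f. Conversely, directional derivatives are unique,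
    so any gradient has the same inner products with all h as Y f and equals it by nondegeneracy. *)
Lemma hankel_generating_functional :
  hankel_form_sym -> is_generating_functional S V.
Proof.
move=> sym; split=> [f g hf hg fg|].
  rewrite /hankel_functional -!/(Y _) -(eq_signed_output B C sigma hA hf hg fg).
  by congr (_ * _); rewrite !(L2innerC _ (Y f)); apply: eq_L2innerr => //; exact: L2Y.
apply/seteqP; split=> a.
  move=> [a1 a2 a12]; split => //; split => // h hh.
  rewrite L2innerC (eq_L2innerr hh a2 (L2Y a1) a12) L2innerC.
  exact: is_derive_hankel_functional.
move=> [a1 [a2 da]]; split => //.
apply: (L2_nondegenerate a2 (L2Y a1)) => h hh; rewrite !(L2innerC h).
have d1 := da h hh; have d2 := is_derive_hankel_functional sym a1 hh.
by rewrite -(@derive_val _ _ _ _ _ _ _ d1) (@derive_val _ _ _ _ _ _ _ d2).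
Qed.

End HankelGraph.

(** The graph does not involve D, so being Lagrangian cannot constrain D; the converse direction
    therefore carries the symmetry of sigma D as a hypothesis. *)
Theorem proposition2 (R : realType) (n m : nat) (A : 'M[R]_n)
    (B : 'M[R]_(n, m)) (C : 'M[R]_(m, n)) (D sigma : 'M[R]_m)
    (hA : hurwitz A) (hsigma : is_signature sigma) :
  (reciprocal A B C D sigma -> lagrangian (hankel_graph A B C sigma)) /\
  (sigma *m D = D^T *m sigma ->
     lagrangian (hankel_graph A B C sigma) -> reciprocal A B C D sigma) /\
  (lagrangian (hankel_graph A B C sigma) ->
     is_generating_functional (hankel_graph A B C sigma)
       (hankel_functional A B C sigma)).
Proof.
split; [|split].
- move=> /(reciprocal_markov hsigma hA) hM; apply/(lagrangian_hankel_graph _ _ _ hA).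
  by move=> u v hu hv; exact: markov_hankel_sym.
- move=> hD /(lagrangian_hankel_graph _ _ _ hA) sym.
  exact: markov_reciprocal (hankel_sym_markov hA sym).
- move=> /(lagrangian_hankel_graph _ _ _ hA); exact: hankel_generating_functional.
Qed.
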